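(* Let $f(x)$ be a polynomial with real or complex coefficients, and for natural numbers $m\ge 1$ let $g(m)=\sum_{x=1}^{m}f(x)$. Then $g(m)$ is a polynomial in $m$ and is divisible by $m$; that is, there is a polynomial $G(t)$ with coefficients in the same field, divisible by $t$ in the polynomial ring, such that $g(m)=G(m)$ for all natural numbers $m\ge 1$.
   Context: Natural numbers are the positive integers. Divisibility is understood as divisibility of polynomials. *)

(* Defs.v *)
From mathcomp Require Import all_boot all_order all_algebra.
From mathcomp Require Import complex.
From mathcomp Require Import reals.

Set Implicit Arguments.
Unset Strict Implicit.
Unset Printing Implicit Defensive.

Import GRing.Theory.
Local Open Scope ring_scope.

Definition partial_sum (F : fieldType) (f : {poly F}) (m : nat) : F :=
  \sum_(1 <= x < m.+1) f.[x%:R].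

(* Main.v *)
Require Import Defs.
From mathcomp Require Import all_boot all_order all_algebra.
From mathcomp Require Import complex.
From mathcomp Require Import reals.
Import GRing.Theory.
Local Open Scope ring_scope.

(** Summation is inverted by the forward difference [p(X + 1) - p(X)], so the
    point is that over a field of characteristic zero every polynomial is a
    forward difference ([fdiff_surj]). The forward differences form a
    subspace, so monomials are enough, and these follow by strong induction
    from the binomial expansion: the difference of [X^(n+1)] is [(n+1) X^n]
    plus a combination of lower powers, and [n+1] is invertible.

    Given [f], choose [G] whose difference is [f(X + 1)] and normalize it by
    [G(0) = 0], which changes no difference. The sum of [f] from [1] to [m]
    then telescopes to [G(m) - G(0) = G(m)], and [G(0) = 0] is precisely
    divisibility by [X]. Real and complex coefficients are both instances. *)

Definition fdiff {F : fieldType} (p : {poly F}) : {poly F} :=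
  p \Po ('X + 1) - p.

Lemma fdiffD (F : fieldType) (p q : {poly F}) :
  fdiff (p + q) = fdiff p + fdiff q.
Proof. by rewrite /fdiff comp_polyD opprD addrACA. Qed.

Lemma fdiffZ (F : fieldType) (c : F) (p : {poly F}) :
  fdiff (c *: p) = c *: fdiff p.
Proof. by rewrite /fdiff comp_polyZ scalerBr. Qed.

Lemma fdiffC (F : fieldType) (c : F) : fdiff c%:P = 0.
Proof. by rewrite /fdiff comp_polyC subrr. Qed.

Lemma fdiffXn (F : fieldType) (n : nat) :
  fdiff 'X^n = \sum_(i < n) 'C(n, i)%:R *: 'X^i :> {poly F}.
Proof.
rewrite /fdiff rmorphXn /= comp_polyX exprD1n big_ord_recr /=.
rewrite binn mulr1n addrK; apply: eq_bigr => i _.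
by rewrite scaler_nat.
Qed.

Lemma fdiff_sum_surj (F : fieldType) (n : nat) (c : nat -> F)
    (h : nat -> {poly F}) :
  (forall i, (i < n)%N -> exists p, fdiff p = h i) ->
  exists p, fdiff p = \sum_(i < n) c i *: h i.
Proof.
move=> hP; apply: (big_ind (fun q => exists p, fdiff p = q)).
- by exists 0%:P; rewrite fdiffC.
- by move=> _ _ [p <-] [q <-]; exists (p + q); rewrite fdiffD.
- by move=> i _; have [p <-] := hP i (ltn_ord i); exists (c i *: p);
    rewrite fdiffZ.
Qed.

(** Solve the binomial expansion of the difference of [X^(n+1)] for its top
    term [(n+1) X^n]; the remaining terms are covered by induction. *)
Lemma fdiffXn_surj (F : fieldType) (n : nat) :
  [pchar F] =i pred0 -> exists p : {poly F}, fdiff p = 'X^n.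
Proof.
move=> /pcharf0P charF; elim/ltn_ind: n => n IHn.
have [q fdiff_q] :=
  @fdiff_sum_surj F n (fun i => 'C(n.+1, i)%:R) (fun i => 'X^i) IHn.
exists (n.+1%:R^-1 *: ('X^(n.+1) + (-1) *: q)).
rewrite fdiffZ fdiffD fdiffZ fdiff_q fdiffXn big_ord_recr /= scaleN1r.
by rewrite addrAC subrr add0r binSn scalerA mulVf ?scale1r ?charF.
Qed.

Lemma fdiff_surj (F : fieldType) (f : {poly F}) :
  [pchar F] =i pred0 -> exists p : {poly F}, fdiff p = f.
Proof.
move=> charF; rewrite -[f]coefK poly_def.
by apply: fdiff_sum_surj => i _; apply: fdiffXn_surj.
Qed.

(** Telescoping is uniform in [m] and includes the empty sum at [m = 0]: that
    instance is the value [G(0) = 0], which is why [X] divides [G]. *)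
Lemma partial_sum_divisible (F : fieldType) (f : {poly F}) :
  [pchar F] =i pred0 ->
  exists G : {poly F},
    'X %| G /\ forall m : nat, partial_sum f m = G.[m%:R].
Proof.
move=> charF; have [p fdiff_p] := fdiff_surj _ (f \Po ('X + 1)) charF.
exists (p - p.[0]%:P); split.
  by rewrite -['X]subr0 -polyC0 dvdp_XsubCl /root !hornerE subrr.
move=> m; rewrite /partial_sum big_add1 /= hornerD hornerN hornerC.
rewrite -(telescope_sumr (fun k => p.[k%:R]) (leq0n m)).
apply: eq_bigr => k _.
(* The summands agree by evaluating, at [k], the defining equation of [p]. *)
have := congr1 (horner^~ k%:R) fdiff_p.
by rewrite /fdiff /= !hornerE !horner_comp !hornerE natr1 => ->.
Qed.

Theorem corollary2p3 (R : realType) :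
  (forall f : {poly R}, exists G : {poly R},
     'X %| G /\ forall m : nat, (1 <= m)%N -> partial_sum f m = G.[m%:R]) /\
  (forall f : {poly R[i]}, exists G : {poly R[i]},
     'X %| G /\ forall m : nat, (1 <= m)%N -> partial_sum f m = G.[m%:R]).
Proof.
split=> f.
- have [G [dvdG sumG]] := partial_sum_divisible _ f (@Num.Theory.pchar_num R).
  by exists G; split=> // m _; apply: sumG.
- have [G [dvdG sumG]] :=
    partial_sum_divisible _ f (@Num.Theory.pchar_num R[i]).
  by exists G; split=> // m _; apply: sumG.
Qed.
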